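(* Let $\kappa_0$ be a sublinear function. For every $\theta\in(0,1]$ and $\lambda\ge 1$ there exists a constant $r=r(\kappa_0,\theta,\lambda)>0$ with the following property. Let $X$ be a geodesic metric space, let $\gamma$ be a Morse geodesic segment in $X$ that is $\kappa_0$-contracting, and let $p$ be a $\theta$-interval of $\gamma$. Then for every $R>4r$, every $\lambda$-Lipschitz path with the same endpoints as $\gamma$ intersects the $r$-neighborhoods of a sequence of pairwise $R$-separated points $x_1,x_2,\ldots,x_N$ on $p$, where $N=\lceil \ell(p)/6R\rceil$.
   Context: A sublinear function is a non-decreasing positive function $\kappa:\mathbb R_+\to\mathbb R_+$ with $\kappa(r)/r\to 0$ as $r\to\infty$. $\ell(\cdot)$ is length. A path $\alpha$ with endpoints $\alpha^-,\alpha^+$ is a $\lambda$-Lipschitz path if $\ell(\alpha)\le\lambda d_X(\alpha^-,\alpha^+)$. For a subset $\gamma\subseteq X$ put $\mathrm{Pr}_\gamma(x)=\{a\in\gamma: d_X(x,a)\le d_X(x,\gamma)+1\}$. A quasi-geodesic $\gamma$ is Morse if and only if its gauge function $r\mapsto \sup\{\mathrm{diam}_X(\mathrm{Pr}_\gamma(B_r(x))): x\in X,\ r=d_X(x,\gamma)\}$ is sublinear; it is called $\kappa_0$-contracting if this gauge function is bounded above by $\kappa_0$ (here $\mathrm{Pr}_\gamma(B_r(x))=\bigcup_{y\in B_r(x)}\mathrm{Pr}_\gamma(y)$). For a geodesic segment $\gamma$ of length $n$ and $0\le\theta_1\le\theta_2\le1$, the $(\theta_1,\theta_2)$-interval of $\gamma$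 is the closed subsegment whose initial and terminal endpoints are at distance $\theta_1 n$ and $\theta_2 n$ from the initial endpoint of $\gamma$. A $\theta$-interval is any $(\theta_1,\theta_2)$-interval with $\theta_2-\theta_1=\theta$. Points are pairwise $R$-separated if any two of them (with distinct indices) are at distance at least $R$. *)

(* Defs.v *)
From HB Require Import structures.
From mathcomp Require Import all_boot all_order all_algebra.
From mathcomp Require Import all_classical all_reals all_analysis.

Set Implicit Arguments.
Unset Strict Implicit.
Unset Printing Implicit Defensive.

Import Order.TTheory GRing.Theory Num.Theory.
Import numFieldNormedType.Exports.

Local Open Scope classical_set_scope.
Local Open Scope ring_scope.

(* Functions on the half-line [0, +oo) are total functions [R -> R] of which
   only the values at nonnegative reals are constrained. *)
Definition sublinear (R : realType) (kappa : R -> R) : Prop :=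
  [/\ forall s t : R, 0 <= s -> s <= t -> kappa s <= kappa t,
      forall t : R, 0 <= t -> 0 < kappa t
    & kappa t / t @[t --> +oo] --> 0].

Definition set_dist (R : realType) (X : metricType R) (x : X) (A : set X) : R :=
  inf [set mdist x a | a in A].

Definition diam (R : realType) (X : metricType R) (A : set X) : \bar R :=
  Order.max 0%E (ereal_sup [set (mdist x y)%:E | x in A & y in A]).

Definition Pr (R : realType) (X : metricType R) (gamma : set X) (x : X)
  : set X := [set a | gamma a /\ mdist x a <= set_dist x gamma + 1].

(* In a metricType, [ball x t] is the open ball. *)
Definition gauge (R : realType) (X : metricType R) (gamma : set X) (t : R)
  : \bar R :=
  ereal_sup [set diam (\bigcup_(y in ball x t) Pr gamma y)
            | x in [set x | t = set_dist x gamma]].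

Definition contracting (R : realType) (X : metricType R) (kappa : R -> R)
    (gamma : set X) : Prop :=
  forall t : R, 0 <= t -> (gauge gamma t <= (kappa t)%:E)%E.

(* Sublinearity of the gauge is meant up to an upper bound: the gauge itself
   need be neither monotone nor positive (for instance, no point of a bounded
   space is at a large distance from gamma). *)
Definition Morse (R : realType) (X : metricType R) (gamma : set X) : Prop :=
  exists2 kappa : R -> R, sublinear kappa & contracting kappa gamma.

(* [gamma], restricted to [0, n], parametrizes a geodesic segment of length
   [n] by arc length; its values outside [0, n] are irrelevant. *)
Definition geodesic_segment (R : realType) (X : metricType R)
    (gamma : R -> X) (n : R) : Prop :=
  0 <= n /\ {in `[0, n] &, forall s t : R, mdist (gamma s) (gamma t) = `|s - t|}.

Definition geodesic_space (R : realType) (X : metricType R) : Prop :=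
  forall x y : X, exists (gamma : R -> X) (n : R),
    [/\ geodesic_segment gamma n, gamma 0 = x & gamma n = y].

Definition trace (R : realType) (X : metricType R) (f : R -> X) (a b : R)
  : set X := [set f t | t in `[a, b]].

Definition path_length (R : realType) (X : metricType R) (f : R -> X) (a b : R)
  : \bar R :=
  ereal_sup [set (let F := f \o nth b (a :: s) in
                  \sum_(0 <= i < size s) mdist (F i) (F i.+1))%:E
            | s in itv_partition a b].

Definition lipschitz_path (R : realType) (X : metricType R) (lambda : R)
    (alpha : R -> X) (a b : R) : Prop :=
  [/\ a <= b, {within `[a, b], continuous alpha}
    & (path_length alpha a b <= (lambda * mdist (alpha a) (alpha b))%:E)%E].

(* Main.v *)
Require Import Defs.
From HB Require Import structures.
From mathcomp Require Import all_boot all_order all_algebra.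
From mathcomp Require Import all_classical all_reals all_analysis.
From mathcomp Require Import ring lra.

(** Let L = theta * n be the length of the interval p. Follow the path by short
    steps and watch its coarse projection to gamma, which must run across p.

    At a point at distance d from gamma, a step of length d / 2 displaces the
    projection by at most kappa0 d, by contraction. Since kappa0 is sublinear,
    there is a threshold D beyond which kappa0 d <= eps * d, twice eps times the
    length of the step ([far_step]). The whole path has length at most
    lambda * n, so the steps made beyond distance D displace the projection by
    at most 2 * eps * lambda * n in total; for eps = theta / (4 * lambda) this is
    half of L. This total does not depend on how high the path climbs, nor on
    how often it comes back to gamma.

    The other half of p is crossed by steps that start at distance less than D
    from gamma. Each of them displaces the projection by at most a constant C
    ([near_step]), and the points of gamma that it crosses are within
    r = D + 1 + C of the path. Choosing such points greedily along p, each at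
    least R beyond the previous one, costs at most R + C <= 2 * R of the length
    per point ([greedy_separated]). Hence L / 2 <= 2 * R * M, where M is the
    number of points chosen, and M >= L / (4 * R) >= L / (6 * R). *)

Set Implicit Arguments.
Unset Strict Implicit.
Unset Printing Implicit Defensive.

Import Order.TTheory GRing.Theory Num.Theory.
Import numFieldNormedType.Exports.

Local Open Scope classical_set_scope.
Local Open Scope ring_scope.

(** * Sublinear functions and coarse projections *)

Lemma sublinear_le_mul (R : realType) (kappa : R -> R) (eps : R) :
  sublinear kappa -> 0 < eps ->
  exists2 D : R, 2 <= D & forall t, D <= t -> kappa t <= eps * t.
Proof.
move=> [_ _ /cvgrPdist_le kappa0] eps0.
have [M [_ kM]] := kappa0 _ eps0.
exists (Num.max 2 (M + 1)); first by rewrite le_max lexx.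
move=> t; rewrite ge_max => /andP[t2 Mt].
have t0 : 0 < t by lra.
have Mltt : M < t by lra.
have /= := kM t Mltt.
rewrite sub0r normrN => /(le_trans (ler_norm _)).
by rewrite ler_pdivrMr.
Qed.

Lemma mdist_set_has_lbound (R : realType) (X : metricType R) (x : X)
    (A : set X) :
  has_lbound [set mdist x a | a in A].
Proof. by exists 0 => _ [a _ <-]; exact: mdist_ge0. Qed.

Lemma set_dist_le_mdist (R : realType) (X : metricType R) (x a : X)
    (A : set X) :
  A a -> set_dist x A <= mdist x a.
Proof. by move=> Aa; apply: (ge_inf (mdist_set_has_lbound x A)); exists a. Qed.

Lemma set_dist_ge0 (R : realType) (X : metricType R) (x : X) (A : set X) :
  0 <= set_dist x A.
Proof.
have [->|/set0P[a Aa]] := eqVneq A set0; first by rewrite /set_dist image_set0 inf0.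
by apply: lb_le_inf => [|_ [b _ <-]]; [exists (mdist x a), a|exact: mdist_ge0].
Qed.

Lemma Pr_nonempty (R : realType) (X : metricType R) (x a : X) (A : set X) :
  A a -> Pr A x !=set0.
Proof.
move=> Aa.
have hinf : has_inf [set mdist x a | a in A].
  by split; [exists (mdist x a), a|exact: mdist_set_has_lbound].
have [_ [b Ab <-] /ltW xb] := inf_adherent ltr01 hinf.
by exists b.
Qed.

Lemma set_dist_le_add (R : realType) (X : metricType R) (x y : X)
    (A : set X) :
  A !=set0 -> set_dist y A <= set_dist x A + mdist x y.
Proof.
move=> [a0 Aa0]; rewrite -lerBlDr.
apply: lb_le_inf; first by exists (mdist x a0), a0.
move=> _ [a Aa <-]; rewrite lerBlDr.
apply: (le_trans (set_dist_le_mdist y Aa)).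
by rewrite addrC (metric_sym x y); exact: metric_triangle.
Qed.

(** The form in which contraction is used: moving away from [x] by less than
    its distance to [A] moves the coarse projection by at most the gauge. *)
Lemma contracting_mdist_Pr (R : realType) (X : metricType R) (kappa : R -> R)
    (A : set X) (x y p q : X) :
  contracting kappa A -> mdist x y < set_dist x A ->
  Pr A x p -> Pr A y q -> mdist p q <= kappa (set_dist x A).
Proof.
move=> hA xy Pp Pq; rewrite -lee_fin.
apply: (le_trans _ (hA _ (set_dist_ge0 x A))).
apply: le_trans; last by apply: ereal_sup_ubound; exists x.
rewrite /diam le_max; apply/orP; right.
have d0 : 0 < set_dist x A by apply: le_lt_trans xy; exact: mdist_ge0.
apply: ereal_sup_ubound; exists p.
  by exists x => //; rewrite ballEmdist /= mdistxx.
by exists q => //; exists y => //; rewrite ballEmdist.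
Qed.

(** Replaces contraction at points close to [A], where the balls allowed in
    [contracting] are too small (or empty) for steps of a definite length. *)
Lemma mdist_Pr_le (R : realType) (X : metricType R) (A : set X)
    (x y p q : X) :
  Pr A x p -> Pr A y q ->
  mdist p q <= 2 * set_dist x A + 2 * mdist x y + 2.
Proof.
move=> [Ap xp] [Aq yq].
have := @set_dist_le_add _ _ x y A (ex_intro _ p Ap).
have := metric_triangle p x q.
have := metric_triangle x y q.
rewrite (metric_sym p x) /=.
lra.
Qed.

(** * Lengths of paths *)

(** Along a geodesic the polygonal sums are the variations of the identity
    function, hence do not depend on the partition. *)
Lemma path_length_geodesic (R : realType) (X : metricType R) (gamma : R -> X)
    (n u v : R) :
  geodesic_segment gamma n -> 0 <= u -> u <= v -> v <= n ->
  path_length gamma u v = (v - u)%:E.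
Proof.
move=> [n0 geo] u0 uv vn.
rewrite -[RHS]ereal_sup1 /path_length; congr ereal_sup.
have sumE s : itv_partition u v s ->
    \sum_(0 <= i < size s) mdist ((gamma \o nth v (u :: s)) i)
                                 ((gamma \o nth v (u :: s)) i.+1) = v - u.
  move=> us; rewrite -[RHS]/(id v - id u).
  rewrite -(@nondecreasing_variation _ u v id s)//.
  apply: eq_big_nat => i /andP[_ si].
  have in0n j : (j < (size s).+1)%N -> nth v (u :: s) j \in `[0, n].
    move=> js; rewrite in_itv /=; apply/andP; split.
      exact: (le_trans u0 (itv_partition_nth_ge js us)).
    exact: (le_trans (itv_partition_nth_le js us) vn).
  by rewrite geo ?in0n ?ltnS ?(ltnW si)// distrC.
apply/seteqP; split => [_ [s us <-]|_ ->].
  by congr EFin; exact: sumE us.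
move: uv; rewrite le_eqVlt => /orP[/eqP uv|uv].
  have part : itv_partition u v [::] by split => //=; rewrite uv.
  by exists [::] => //; congr EFin; exact: sumE part.
have part := itv_partition1 uv.
by exists [:: v] => //; congr EFin; exact: sumE part.
Qed.

(** The times [tau] may repeat while a partition is strictly increasing, so the
    partition is built one time at a time, skipping the repetitions. *)
Lemma sum_mdist_le_path_length (R : realType) (X : metricType R)
    (alpha : R -> X) (a b : R) (tau : nat -> R) (K : nat) :
  tau 0 = a -> {homo tau : i j / (i <= j)%N >-> i <= j} ->
  (forall k, tau k <= b) ->
  ((\sum_(k < K) mdist (alpha (tau k)) (alpha (tau k.+1)))%:E
     <= path_length alpha a b)%E.
Proof.
move=> tau0 tau_homo taub.
pose len s := \sum_(0 <= i < size s) mdist (alpha (nth b (a :: s) i))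
                                           (alpha (nth b (a :: s) i.+1)).
have len_rcons s x : len (rcons s x) = len s + mdist (alpha (last a s)) (alpha x).
  have nthE i : (i <= size s)%N -> nth b (a :: rcons s x) i = nth b (a :: s) i.
    by rewrite -rcons_cons nth_rcons /= ltnS => ->.
  rewrite /len size_rcons big_nat_recr //= nth_rcons ltnn eqxx (last_nth b).
  rewrite (nthE (size s))//; congr (_ + _).
  by apply: eq_big_nat => i /andP[_ si]; rewrite (nthE i (ltnW si)); have /= -> := nthE _ si.
have extend s x : path <%R a s -> last a s <= x ->
    exists2 s', path <%R a s' /\ last a s' = x &
                len s' = len s + mdist (alpha (last a s)) (alpha x).
  move=> as_; rewrite le_eqVlt => /orP[/eqP <-|sx].
    by exists s => //; rewrite mdistxx addr0.
  exists (rcons s x); last exact: len_rcons.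
  by rewrite rcons_path as_ sx last_rcons.
have [s [as_ sK] sumE] : exists2 s, path <%R a s /\ last a s = tau K &
    len s = \sum_(k < K) mdist (alpha (tau k)) (alpha (tau k.+1)).
  elim: K => [|K [s [as_ sK] sumE]].
    by exists [::]; rewrite ?tau0 // /len big_nil big_ord0.
  have [|s' s'P lenE] := extend s (tau K.+1) as_; first by rewrite sK tau_homo.
  by exists s' => //; rewrite lenE sumE sK big_ord_recr.
have [|s' [as' s'b] lenE] := extend s b as_; first by rewrite sK.
apply: (@le_trans _ _ (len s')%:E); first by rewrite lee_fin lenE sumE lerDl mdist_ge0.
by apply: ereal_sup_ubound; exists s' => //; split => //; rewrite s'b.
Qed.

(** * Cutting a path into steps of prescribed size *)

Lemma continuous_mdist (R : realType) (X : metricType R) (x : X) :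
  continuous (mdist x : X -> R).
Proof.
move=> y; apply/cvgrPdist_lt => e e0.
have : nbhs y (ball y e) by exact: nbhsx_ballx.
apply: filterS => z; rewrite ballEmdist /= => yz.
have := metric_triangle x y z; have := metric_triangle x z y.
by rewrite (metric_sym z) ltr_norml => h1 h2; apply/andP; split; lra.
Qed.

(** By the intermediate value theorem applied to the distance from [alpha t]. *)
Lemma exists_next_step (R : realType) (X : metricType R) (alpha : R -> X)
    (a b t h : R) :
  {within `[a, b], continuous alpha} -> a <= t -> t <= b -> 0 <= h ->
  exists t', [/\ t <= t', t' <= b &
    mdist (alpha t) (alpha t') = h \/
    t' = b /\ mdist (alpha t) (alpha t') <= h].
Proof.
move=> calpha at_ tb h0.
have [bh|/ltW hb] := leP (mdist (alpha t) (alpha b)) h.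
  by exists b; split => //; right.
have cf : {within `[t, b], continuous (mdist (alpha t) \o alpha)}.
  apply: within_continuous_comp => [x _|]; first exact: continuous_mdist.
  apply: continuous_subspaceW calpha => s /=; rewrite !in_itv /= => /andP[ts ->].
  by rewrite (le_trans at_ ts).
have [|t' ] := @IVT _ _ t b h tb cf.
  by rewrite /= mdistxx ge_min h0 /= le_max hb orbT.
by rewrite in_itv /= => /andP[tt' t'b] hE; exists t'; split => //; left.
Qed.

(** Every step that does not end at [b] has length at least [1], so a path of
    finite length reaches [b] after finitely many steps. *)
Lemma exists_step_sequence (R : realType) (X : metricType R) (alpha : R -> X)
    (a b l : R) (step : X -> R) :
  a <= b -> {within `[a, b], continuous alpha} ->
  (path_length alpha a b <= l%:E)%E -> (forall x, 1 <= step x) ->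
  exists (tau : nat -> R) (K : nat), [/\ tau 0 = a, tau K = b,
    forall k, a <= tau k <= b,
    forall k, mdist (alpha (tau k)) (alpha (tau k.+1)) = step (alpha (tau k)) \/
      tau k.+1 = b /\
      mdist (alpha (tau k)) (alpha (tau k.+1)) <= step (alpha (tau k)) &
    \sum_(k < K) mdist (alpha (tau k)) (alpha (tau k.+1)) <= l].
Proof.
move=> ab calpha len step1.
have nextP t : exists t', a <= t <= b -> [/\ t <= t', t' <= b &
    mdist (alpha t) (alpha t') = step (alpha t) \/
    t' = b /\ mdist (alpha t) (alpha t') <= step (alpha t)].
  have [/andP[at_ tb]|ntab] := boolP (a <= t <= b); last by exists t.
  have step0 : 0 <= step (alpha t) by apply: le_trans (step1 _).
  by have [t' ?] := exists_next_step calpha at_ tb step0; exists t'.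
have [next {}nextP] := choice nextP.
pose tau k := iter k next a.
have tauab k : a <= tau k <= b.
  elim: k => [|k IH]; first by rewrite lexx ab.
  have [lek leb _] := nextP _ IH.
  by move: IH => /andP[ak _]; rewrite (le_trans ak lek).
have tau_homo : {homo tau : i j / (i <= j)%N >-> i <= j}.
  apply: homo_leq => //; first exact: le_trans.
  by move=> k; have [] := nextP _ (tauab k).
have sum_le K : \sum_(k < K) mdist (alpha (tau k)) (alpha (tau k.+1)) <= l.
  rewrite -lee_fin; apply: le_trans len.
  by apply: sum_mdist_le_path_length => // k; have /andP[] := tauab k.
exists tau.
suff [K tauK] : exists K, tau K = b.
  by exists K; split => // k; have [] := nextP _ (tauab k).
apply: contrapT => never.
have [n ln] : exists n : nat, l < n%:R.
  by exists (Num.truncn `|l|).+1; apply: le_lt_trans (ler_norm l) (truncnS_gt _).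
suff : n%:R <= l by rewrite leNgt ln.
apply: le_trans (sum_le n).
rewrite -[n in n%:R]card_ord -sumr_const; apply: ler_sum => k _.
have [_ _ [->|[taub _]]] := nextP _ (tauab k); first exact: step1.
by case: never; exists k.+1.
Qed.

(** * Greedy selection of separated values *)

(** The increase of [m] is shared between [e], which pays for the bad steps, and
    the selected values: whenever [m] is at a good value at least [sep] above the
    last selected one, select it. Between two selections [m] gains at most [sep]
    before the next good step and [C] during that step, apart from what [e]
    pays. The list [s] is in reverse order of selection. *)
Lemma greedy_separated (R : realType) (m e : nat -> R) (good : R -> Prop)
    (C sep : R) (K : nat) :
  0 <= sep -> (forall k, 0 <= e k) ->
  (forall k, (k < K)%N ->
     good (m k) /\ m k.+1 <= m k + C \/ m k.+1 <= m k + e k) ->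
  exists s : seq R, [/\ forall t, t \in s -> good t,
    sorted (fun t t' => t' + sep <= t) s &
    m K <= m 0 + \sum_(k < K) e k + (size s)%:R * (sep + C)].
Proof.
move=> sep0 e0 stepP.
(* The induction needs the bound at the last selected value itself: the next
   good steps stay below that value plus [sep + C] as long as nothing is
   selected. *)
suff [s [sgood ssorted snil scons]] : exists s : seq R,
  [/\ forall t, t \in s -> good t, sorted (fun t t' => t' + sep <= t) s,
      s = [::] -> m K <= m 0 + \sum_(k < K) e k &
      forall t s', s = t :: s' ->
        let B := m 0 + \sum_(k < K) e k + (size s')%:R * (sep + C) in
        t <= B /\ m K <= B + (sep + C)].
  exists s; split => //.
  case: s snil scons {sgood ssorted} => [sE _|t s' _ sE].
    by rewrite mul0r addr0 sE.
  by have [_] := sE t s' erefl; rewrite /= -natr1; lra.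
elim: K stepP => [|K IH] stepP.
  by exists [::]; split => // _; rewrite big_ord0 addr0.
have [s [sgood ssorted snil scons]] := IH (fun k kK => stepP k (ltnW kK)).
rewrite big_ord_recr /=; have eK0 := e0 K.
case: (stepP K (ltnSn K)) => [[gK mK]|mK]; last first.
  exists s; split => // [/snil|t s' /scons]; first by lra.
  by case=> h1 h2; split; lra.
case: s => [|t s'] in sgood ssorted snil scons *.
  have mK0 := snil erefl.
  exists [:: m K]; split => // [t|t s' [<- <-]]; first by rewrite inE => /eqP ->.
  by rewrite mul0r; split; lra.
have [h1 h2] := scons t s' erefl.
have [tK|Kt] := leP (t + sep) (m K).
  exists [:: m K, t & s']; split => //.
  - by move=> t'; rewrite inE => /orP[/eqP ->|/sgood].
  - by rewrite /= tK.
  - by move=> _ _ [<- <-] /=; rewrite -natr1; split; lra.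
exists (t :: s'); split => // _ _ [<- <-].
by split; lra.
Qed.

(** * Paths following a contracting geodesic *)

(** The last clause makes the projection exact on the geodesic, so that the
    ends of a path with the same endpoints project to the parameters [0] and
    [n], with no additive error. *)
Lemma exists_projection (R : realType) (X : metricType R) (gamma : R -> X)
    (n : R) :
  0 <= n ->
  exists q : X -> R, forall x, [/\ 0 <= q x <= n,
    Pr (trace gamma 0 n) x (gamma (q x)) &
    trace gamma 0 n x -> gamma (q x) = x].
Proof.
move=> n0.
suff /choice[q qP] : forall x, exists t, [/\ 0 <= t <= n,
    Pr (trace gamma 0 n) x (gamma t) & trace gamma 0 n x -> gamma t = x].
  by exists q.
move=> x.
have [[t tn <-]|xG] := pselect (trace gamma 0 n x).
  exists t; split; [by []| |by []].
  by split; [exists t|rewrite mdistxx addr_ge0 ?set_dist_ge0].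
have G0 : trace gamma 0 n (gamma 0) by exists 0; rewrite //= in_itv /= lexx n0.
have [_ [[t tn <-] xt]] := Pr_nonempty x G0.
by exists t; split; [by []|split => //; exists t|by []].
Qed.

(** Half the distance to [A] keeps a step inside the ball to which contraction
    applies; near [A] this is replaced by [1], so that steps are bounded below
    and a path of finite length has finitely many of them. *)
Definition step_size (R : realType) (X : metricType R) (A : set X) (x : X) : R :=
  if set_dist x A < 2 then 1 else set_dist x A / 2.

Lemma step_size_ge1 (R : realType) (X : metricType R) (A : set X) (x : X) :
  1 <= step_size A x.
Proof. by rewrite /step_size; case: ltP => // ?; lra. Qed.

(** The constant [8] bounds the displacement of the projection for a step of
    length [1] from a point at distance less than [2] from [A]. *)
Lemma near_step (R : realType) (X : metricType R) (kappa : R -> R)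
    (A : set X) (D : R) (x y p q : X) :
  sublinear kappa -> contracting kappa A ->
  mdist x y <= step_size A x -> Pr A x p -> Pr A y q ->
  set_dist x A < D -> mdist p q <= 8 + kappa D.
Proof.
move=> [kappa_homo kappa_gt0 _] hA xy Pp Pq xD.
have d0 := set_dist_ge0 x A.
have kD : 0 < kappa D by apply: kappa_gt0; lra.
move: xy; rewrite /step_size; case: ltP => d2 xy.
  by have := mdist_Pr_le Pp Pq; lra.
have := @contracting_mdist_Pr _ _ kappa A x y p q hA _ Pp Pq.
have := kappa_homo _ _ d0 (ltW xD).
by move=> h1 h2; have := h2 (ltac:(lra)); lra.
Qed.

(** A far step is half as long as the distance to [A], and contraction bounds
    the displacement of the projection by [eps] times that distance. *)
Lemma far_step (R : realType) (X : metricType R) (kappa : R -> R)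
    (A : set X) (D eps : R) (x y p q : X) :
  contracting kappa A -> 2 <= D -> (forall t, D <= t -> kappa t <= eps * t) ->
  mdist x y = step_size A x -> Pr A x p -> Pr A y q ->
  D <= set_dist x A -> mdist p q <= 2 * eps * mdist x y.
Proof.
move=> hA D2 kD xy Pp Pq xD; have kx := kD _ xD.
have stepE : step_size A x = set_dist x A / 2.
  by rewrite /step_size; case: ltP => // ?; lra.
rewrite stepE in xy.
have := @contracting_mdist_Pr _ _ kappa A x y p q hA _ Pp Pq.
rewrite {2}xy => h; have := h (ltac:(lra)); nra.
Qed.

(** The path is cut into steps of [step_size] and its projection parameters
    [q (y k)] are replaced by their running maximum [m], started at [u] and
    capped at [v]. When [m] increases, it was just above the current projection
    parameter. So an increase at a near step puts [gamma (m k)] close to the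
    path, and the increases at far steps add up to at most [2 * eps * l]. *)
Lemma separated_points_near_path (R : realType) (kappa : R -> R) (D eps : R)
    (X : metricType R) (gamma : R -> X) (n : R) (alpha : R -> X)
    (a b l u v sep : R) :
  sublinear kappa -> 2 <= D -> 0 <= eps ->
  (forall t, D <= t -> kappa t <= eps * t) ->
  geodesic_segment gamma n -> contracting kappa (trace gamma 0 n) ->
  a <= b -> {within `[a, b], continuous alpha} ->
  (path_length alpha a b <= l%:E)%E -> alpha a = gamma 0 -> alpha b = gamma n ->
  0 <= u -> u <= v -> v <= n -> 0 <= sep ->
  let C := 8 + kappa D in
  exists s : seq R, [/\
    forall t, t \in s -> u <= t <= v /\
      exists2 w, a <= w <= b & mdist (gamma t) (alpha w) < D + 1 + C,
    sorted (fun t t' => t' + sep <= t) s &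
    v - u <= 2 * eps * l + (size s)%:R * (sep + C)].
Proof.
move=> hkappa D2 eps0 kD [n0 geo] hgamma ab calpha len alphaa alphab
  u0 uv vn sep0 C.
set G := trace gamma 0 n in hgamma.
have in0n t : 0 <= t -> t <= n -> t \in `[0, n] by move=> *; rewrite in_itv; apply/andP.
have [q qP] := @exists_projection _ _ gamma n n0.
have qE t : 0 <= t -> t <= n -> q (gamma t) = t.
  move=> t0 tn; have [/andP[q0 qn] _ qG] := qP (gamma t).
  have := geo _ _ (in0n _ q0 qn) (in0n _ t0 tn).
  rewrite qG; last by exists t => //; exact: in0n.
  by rewrite mdistxx => /esym/normr0_eq0/subr0_eq.
have [tau [K [tau0 tauK tauab tau_step sum_le]]] :=
  exists_step_sequence ab calpha len (step_size_ge1 G).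
pose y k := alpha (tau k).
pose m := fix m k :=
  if k is j.+1 then Num.min v (Num.max (m j) (q (y j.+1))) else u.
have muv k : u <= m k <= v.
  elim: k => [|k /andP[um mv]] /=; first by rewrite lexx uv.
  by rewrite le_min ge_min le_max um uv lexx.
have qm k : Num.min v (q (y k)) <= m k.
  case: k => [|k] /=; last by rewrite le_min !ge_min !le_max !lexx !orbT.
  by rewrite /y tau0 alphaa qE // ge_min u0 orbT.
have mK : m K = v.
  have := qm K; rewrite /y tauK alphab qE // (min_idPl vn) => vm.
  by apply/le_anti; rewrite vm; case/andP: (muv K) => _ ->.
pose e k := if D <= set_dist (y k) G then 2 * eps * mdist (y k) (y k.+1) else 0.
have e0 k : 0 <= e k.
  by rewrite /e; case: ifP => // _; rewrite mulr_ge0 ?mdist_ge0// mulr_ge0.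
have sum_e : \sum_(k < K) e k <= 2 * eps * l.
  apply: (@le_trans _ _ (\sum_(k < K) 2 * eps * mdist (y k) (y k.+1))).
    apply: ler_sum => k _; rewrite /e; case: ifP => // _.
    by rewrite mulr_ge0 ?mdist_ge0// mulr_ge0.
  by rewrite -mulr_sumr ler_wpM2l // mulr_ge0.
pose good t := u <= t <= v /\
  exists2 w, a <= w <= b & mdist (gamma t) (alpha w) < D + 1 + C.
have [|s [sgood ssorted sK]] := @greedy_separated _ m e good C sep K sep0 e0.
  move=> k _.
  have [mk|mk] := leP (m k.+1) (m k); first by right; rewrite (le_trans mk)// lerDl.
  have /andP[um mv] := muv k.
  have mkv : m k < v by apply: lt_le_trans mk _; case/andP: (muv k.+1).
  have qmk : q (y k) <= m k.
    by have := qm k; rewrite ge_min leNgt mkv.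
  have mkq : m k.+1 <= q (y k.+1).
    by move: mk; rewrite /= lt_min lt_max ltxx /= ge_min ge_max lexx => /andP[_ /ltW ->]; rewrite orbT.
  have [/andP[q0 qn] Pp _] := qP (y k).
  have [/andP[q0' qn'] Pp' _] := qP (y k.+1).
  have pq : mdist (gamma (q (y k))) (gamma (q (y k.+1))) = q (y k.+1) - q (y k).
    by rewrite geo ?in0n// distrC ger0_norm //; lra.
  have ystep : mdist (y k) (y k.+1) <= step_size G (y k).
    by case: (tau_step k) => [-> //|[]].
  have [far|near] := leP D (set_dist (y k) G).
    right; rewrite /e far.
    (* A truncated last step ends on the geodesic, hence is at least as long as
       the distance to it, which exceeds the size of a far step. *)
    have ystepE : mdist (y k) (y k.+1) = step_size G (y k).
      case: (tau_step k) => // -[taub _].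
      have Gb : G (y k.+1) by rewrite /y taub alphab; exists n => //; exact: in0n.
      have := set_dist_le_mdist (y k) Gb.
      by move: ystep; rewrite /step_size; case: ltP => _; lra.
    have := far_step hgamma D2 kD ystepE Pp Pp' far.
    by rewrite pq; lra.
  left; have := near_step hkappa hgamma ystep Pp Pp' near.
  rewrite pq -/C => qC; split; last by lra.
  split; first exact: muv.
  exists (tau k); first exact: tauab.
  have [_ ] := Pp; rewrite metric_sym.
  have := metric_triangle (gamma (m k)) (gamma (q (y k))) (y k).
  rewrite geo ?in0n ?(le_trans u0 um) ?(le_trans mv vn)// ger0_norm; last by lra.
  by rewrite -/(y k); lra.
exists s; split => //.
by move: sK; rewrite mK /=; lra.
Qed.

Theorem lemma1p1 (R : realType) (kappa0 : R -> R) (hkappa0 : sublinear kappa0)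
    (theta lambda : R) (htheta0 : 0 < theta) (htheta1 : theta <= 1)
    (hlambda : 1 <= lambda) :
  exists2 r : R, 0 < r &
    forall (X : metricType R) (gamma : R -> X) (n theta1 theta2 : R),
    geodesic_space X ->
    geodesic_segment gamma n ->
    Morse (trace gamma 0 n) ->
    contracting kappa0 (trace gamma 0 n) ->
    0 <= theta1 -> theta1 <= theta2 -> theta2 <= 1 -> theta2 - theta1 = theta ->
    forall (sep : R) (alpha : R -> X) (a b : R),
    4 * r < sep ->
    lipschitz_path lambda alpha a b ->
    alpha a = gamma 0 -> alpha b = gamma n ->
    let u := theta1 * n in
    let v := theta2 * n in
    let N := `|Num.ceil (fine (path_length gamma u v) / (6 * sep))|%N in
    exists x : 'I_N -> X,
      [/\ forall i, trace gamma u v (x i),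
          forall i j, i != j -> sep <= mdist (x i) (x j)
        & forall i, trace alpha a b `&` ball (x i) r !=set0].
Proof.
have lambda0 : 0 < lambda by lra.
(* With this slope the far steps, whose lengths add up to at most [lambda * n],
   displace the projection by at most half the length [theta * n] of the
   interval. *)
pose eps := theta / (4 * lambda).
have eps0 : 0 < eps by rewrite divr_gt0 // mulr_gt0.
have [D D2 kD] := sublinear_le_mul hkappa0 eps0.
have kD0 : 0 < kappa0 D by case: hkappa0 => _ + _; apply; lra.
exists (D + 1 + (8 + kappa0 D)); first by lra.
move=> X gamma n theta1 theta2 _ hgeo _ hgamma theta1_ge0 theta12 theta2_le1 thetaE.
move=> sep alpha a b hsep [ab calpha len] alphaa alphab u v N.
have [n0 geo] := hgeo.
have in0n t : 0 <= t -> t <= n -> t \in `[0, n] by move=> *; rewrite in_itv; apply/andP.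
have u0 : 0 <= u by exact: mulr_ge0.
have uv : u <= v by exact: ler_wpM2r.
have vn : v <= n by exact: ler_piMl.
have uvE : v - u = theta * n by rewrite -mulrBl thetaE.
have sep0 : 0 <= sep by lra.
move: len; rewrite alphaa alphab geo ?in0n// sub0r normrN ger0_norm// => len.
have [s [sP ssorted vu_le]] := separated_points_near_path hkappa0 D2 (ltW eps0) kD
  hgeo hgamma ab calpha len alphaa alphab u0 uv vn sep0.
have epsE : 2 * eps * (lambda * n) = theta * n / 2.
  by rewrite /eps; field; rewrite gt_eqF.
(* The far steps cover at most half of [v - u], and each selected point
   accounts for at most [2 * sep] of the rest: [size s] is at least
   [(v - u) / (4 * sep)]. *)
have Ns : (N <= size s)%N.
  have xge0 : 0 <= (v - u) / (6 * sep) by rewrite divr_ge0 ?subr_ge0// mulr_ge0.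
  have cge0 : 0 <= Num.ceil ((v - u) / (6 * sep)).
    by rewrite ceil_ge0; lra.
  rewrite /N (path_length_geodesic hgeo u0 uv vn) /= -lez_nat gez0_abs // ceil_le_int.
  rewrite ler_pdivrMr; last by lra.
  rewrite epsE -uvE in vu_le.
  have s0 : 0 <= (size s)%:R :> R by exact: ler0n.
  rewrite -pmulrn.
  nra.
have sub_s (i : 'I_N) : (i < size s)%N := leq_trans (ltn_ord i) Ns.
pose t (i : 'I_N) := nth 0 s i.
have tP i := sP _ (mem_nth 0 (sub_s i)).
have t0n i : t i \in `[0, n].
  have [/andP[ut tv] _] := tP i.
  by apply: in0n; [exact: le_trans u0 ut|exact: le_trans tv vn].
have rel_trans : transitive (fun t t' : R => t' + sep <= t).
  by move=> y x z; lra.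
have tsep (i j : 'I_N) : (i < j)%N -> sep <= mdist (gamma (t i)) (gamma (t j)).
  move=> ij; have := sorted_ltn_nth rel_trans 0 ssorted i j (sub_s i) (sub_s j) ij.
  rewrite geo // -/(t i) -/(t j) => ?.
  by apply: le_trans (ler_norm _); lra.
exists (gamma \o t); split => [i|i j|i].
- by exists (t i) => //; rewrite /= in_itv; case: (tP i).
- by rewrite -val_eqE neq_ltn => /orP[|] /tsep //; rewrite metric_sym.
- have [_ [w wab tw]] := tP i.
  exists (alpha w); split; first by exists w => //; rewrite /= in_itv.
  by rewrite ballEmdist.
Qed.
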